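(* Let $\mathbb{F}$ be a finite field, $d\ge 2$ and $\epsilon>0$ be fixed, and let $r=r(n)$ satisfy $r\le(1-\epsilon)n/2$. Let $T$ be drawn from $\mathcal{T}^{(r)}_{d,n}(\mathbb{F})$. Then, as $n\to\infty$, $$\mathbb{E}_T\,\mathrm{bias}(T)=(1+o(1))\,|\mathbb{F}|^{-r}.$$
   Context: A $d$-linear form is a map $T\colon(\mathbb{F}^n)^d\to\mathbb{F}$ linear in each of its $d$ vector variables $x^{(1)},\dots,x^{(d)}$. For such $T$, $\mathrm{bias}(T)=\Pr[T=0]-\Pr[T=y]$ for any nonzero $y\in\mathbb{F}$ (independent of $y$), the probability over a uniformly random point of $(\mathbb{F}^n)^d$. The distribution $\mathcal{T}^{(r)}_{d,n}(\mathbb{F})$ is that of $T=\sum_{i=1}^r S_iR_i$, a sum of $r$ independent random reducible $d$-linear forms: for each $i$ there is a (fixed) nonempty proper subset $I_i\subsetneq[d]$ of the vector variables, and $S_i$, $R_i$ are independent uniformly random multilinear forms in the variables indexed by $I_i$ and by $[d]\setminus I_i$ respectively (i.e., all their coefficients are independent and uniform in $\mathbb{F}$). *)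

(* Defs.v *)
From HB Require Import structures.
From mathcomp Require Import all_boot all_order all_algebra.

Set Implicit Arguments.
Unset Strict Implicit.
Unset Printing Implicit Defensive.

Import GRing.Theory.
Local Open Scope ring_scope.

Definition unif_prob (R : realFieldType) (W : finType) (P : pred W) : R :=
  #|P|%:R / #|W|%:R.

Definition unif_expect (R : realFieldType) (W : finType) (f : W -> R) : R :=
  (\sum_(w : W) f w) / #|W|%:R.

Definition vpoint (F : finFieldType) (d n : nat) : finType :=
  {ffun 'I_d -> 'rV[F]_n}.

Definition set_var (F : finFieldType) (d n : nat) (x : vpoint F d n)
    (j : 'I_d) (v : 'rV[F]_n) : vpoint F d n :=
  [ffun i => if i == j then v else x i].

Definition multilinear (F : finFieldType) (d n : nat)
    (T : vpoint F d n -> F) : Prop :=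
  forall (x : vpoint F d n) (j : 'I_d) (a : F) (u v : 'rV[F]_n),
    T (set_var x j (a *: u + v)) = a * T (set_var x j u) + T (set_var x j v).

(* Any nonzero value may replace 1 when T is multilinear and d > 0: see
   bias_indep below. *)
Definition bias (R : realFieldType) (F : finFieldType) (d n : nat)
    (T : vpoint F d n -> F) : R :=
  unif_prob R [pred x | T x == 0] - unif_prob R [pred x | T x == 1].

(* Coefficient tensors of multilinear forms in the variables indexed by A:
   one coefficient for each choice of a coordinate in every variable of A. *)
Definition coef_tensor (F : finFieldType) (d n : nat) (A : {set 'I_d}) : finType :=
  {ffun {ffun {i : 'I_d | i \in A} -> 'I_n} -> F}.

Definition form_of (F : finFieldType) (d n : nat) (A : {set 'I_d})
    (c : coef_tensor F n A) (x : vpoint F d n) : F :=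
  \sum_(k : {ffun {i : 'I_d | i \in A} -> 'I_n})
    c k * \prod_(i : {i : 'I_d | i \in A}) x (val i) 0 (k i).

(* The uniform law on this finite product makes the coefficients of all the
   S_i and R_i independent and uniform in F. *)
Definition sample (F : finFieldType) (d n r : nat)
    (I : 'I_r -> {set 'I_d}) : finType :=
  {dffun forall i : 'I_r,
     (coef_tensor F n (I i) * coef_tensor F n (~: I i))%type}.

Definition random_form (F : finFieldType) (d n r : nat)
    (I : 'I_r -> {set 'I_d}) (w : sample F n I) (x : vpoint F d n) : F :=
  \sum_(i < r) form_of (w i).1 x * form_of (w i).2 x.

Definition expected_bias (R : realFieldType) (F : finFieldType) (d n r : nat)
    (I : 'I_r -> {set 'I_d}) : R :=
  unif_expect (fun w : sample F n I => bias R (random_form w)).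

Definition nonempty_proper (d : nat) (A : {set 'I_d}) : bool :=
  (A != set0) && (A \proper [set: 'I_d]).

Lemma form_of_in (F : finFieldType) (d n : nat) (A : {set 'I_d})
    (c : coef_tensor F n A) (x : vpoint F d n) (j : 'I_d) (a : F)
    (u v : 'rV[F]_n) : j \in A ->
  form_of c (set_var x j (a *: u + v)) =
  a * form_of c (set_var x j u) + form_of c (set_var x j v).
Proof.
move=> jA; rewrite /form_of mulr_sumr -big_split /=; apply: eq_bigr => k _.
pose j' : {i : 'I_d | i \in A} := exist _ j jA.
rewrite !(bigD1 (P := predT) j') //= !ffunE eqxx !mxE.
have E w : \prod_(i | i != j') (set_var x j w) (sval i) 0 (k i) =
           \prod_(i | i != j') x (sval i) 0 (k i).
  apply: eq_bigr => i ij; rewrite ffunE ifN //.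
by rewrite !E mulrDl mulrDr -(mulrA a) (mulrCA (c k)).
Qed.

Lemma form_of_out (F : finFieldType) (d n : nat) (A : {set 'I_d})
    (c : coef_tensor F n A) (x : vpoint F d n) (j : 'I_d) (u : 'rV[F]_n) :
  j \notin A -> form_of c (set_var x j u) = form_of c x.
Proof.
move=> jA; apply: eq_bigr => k _; congr (_ * _); apply: eq_bigr => i _.
rewrite ffunE ifN //; apply: contraNN jA => /eqP <-; exact: valP.
Qed.

Lemma random_form_multilinear (F : finFieldType) (d n r : nat)
    (I : 'I_r -> {set 'I_d}) (w : sample F n I) :
  multilinear (random_form w).
Proof.
move=> x j a u v; rewrite /random_form mulr_sumr -big_split /=.
apply: eq_bigr => i _; case: (boolP (j \in I i)) => jI.
  have jC : j \notin ~: I i by rewrite inE negbK.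
  by rewrite (form_of_in _ _ _ _ _ jI) !(form_of_out _ _ _ jC) mulrDl mulrA.
have jC : j \in ~: I i by rewrite inE.
by rewrite (form_of_in _ _ _ _ _ jC) !(form_of_out _ _ _ jI) mulrDr mulrCA.
Qed.

Lemma bias_indep (R : realFieldType) (F : finFieldType) (d n : nat)
    (T : vpoint F d n -> F) (y : F) :
  (0 < d)%N -> multilinear T -> y != 0 ->
  bias R T = unif_prob R [pred x | T x == 0] - unif_prob R [pred x | T x == y].
Proof.
case: d T => // d T _ mT y0; congr (_ - _); congr (_%:R / _).
pose h (a : F) (x : vpoint F d.+1 n) := set_var x ord0 (a *: x ord0).
have hid x : set_var x ord0 (x ord0) = x.
  by apply/ffunP => i; rewrite ffunE; case: eqP => // ->.
have Th0 x : T (set_var x ord0 0) = 0.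
  have := mT x ord0 1 0 0; rewrite scale1r addr0 mul1r => /eqP.
  by rewrite -subr_eq subrr => /eqP <-.
have Th a x : T (h a x) = a * T x.
  by have := mT x ord0 a (x ord0) 0; rewrite addr0 hid Th0 addr0.
have hK a : a != 0 -> cancel (h a) (h a^-1).
  move=> a0 x; apply/ffunP => i; rewrite !ffunE eqxx.
  by case: eqP => // ->; rewrite scalerA mulVf // scale1r.
rewrite -(card_image (can_inj (hK y y0))); apply: eq_card => x.
have yV : y^-1 != 0 by rewrite invr_eq0.
have hK' : cancel (h y^-1) (h y) by have := hK _ yV; rewrite invrK.
apply/imageP/idP => [[z /[!inE] /eqP Tz ->]|/[!inE] /eqP Tx].
  by rewrite Th Tz mulr1.
by exists (h y^-1 x); rewrite ?hK' // inE Th Tx mulVf.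
Qed.

(* Main.v *)
Require Import Defs.
From HB Require Import structures.
From mathcomp Require Import all_boot all_order all_algebra.
From mathcomp Require Import all_classical all_reals all_analysis.
From mathcomp Require Import ring zify.

Set Implicit Arguments.
Unset Strict Implicit.
Unset Printing Implicit Defensive.

Import Order.TTheory GRing.Theory Num.Theory.
Import numFieldNormedType.Exports.

Local Open Scope classical_set_scope.
Local Open Scope ring_scope.

(** Exchange the two expectations and fix the point [x]. If some [x_j] is zero
    then every [T(x)] vanishes. Otherwise the values [S_i(x)] and [R_i(x)] are
    independent and uniform: when all the [S_i(x)] vanish, which happens with
    probability [q^-r], [T(x) = 0]; otherwise [T(x)] is uniform and contributes
    nothing to the bias. Hence [E bias(T) = q^-r + p (1 - q^-r)] with
    [p = Pr(some x_j = 0) <= d q^-n], and the relative error [p (q^r - 1)] is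
    at most [d q^(r-n)]. *)

(** * Values of a multilinear form at a fixed point *)

Section FormOf.
Variables (F : finFieldType) (d n : nat) (x : vpoint F d n).

(** Translating by [a * e] permutes the tensors and moves the value at [x] by a known amount; such
    bijections carry all the uniformity arguments below. *)
Definition tensor_axpy (A : {set 'I_d}) (a : F) (e c : coef_tensor F n A) :
  coef_tensor F n A := [ffun k => c k + a * e k].

Lemma tensor_axpyK (A : {set 'I_d}) (a : F) (e : coef_tensor F n A) :
  cancel (tensor_axpy a e) (tensor_axpy (- a) e).
Proof. by move=> c; apply/ffunP => k; rewrite !ffunE mulNr addrK. Qed.

Lemma form_of_axpy (A : {set 'I_d}) (a : F) (e c : coef_tensor F n A) :
  form_of (tensor_axpy a e c) x = form_of c x + a * form_of e x.
Proof.
rewrite /form_of mulr_sumr -big_split /=; apply: eq_bigr => k _.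
by rewrite ffunE mulrDl mulrA.
Qed.

(** Pick a nonzero coordinate of each [x j]; the tensor supported on that single multi-index [K],
    with the inverse of its monomial at [x] as coefficient, works. *)
Lemma form_of_eq1 (A : {set 'I_d}) : (forall j, x j != 0) ->
  exists c : coef_tensor F n A, form_of c x = 1.
Proof.
move=> x0.
have /fin_all_exists [k0 Hk0] j : exists k : 'I_n, x j 0 k != 0.
  exact/rV0Pn.
pose K : {ffun {i : 'I_d | i \in A} -> 'I_n} := [ffun i => k0 (val i)].
pose p := \prod_(i : {i : 'I_d | i \in A}) x (val i) 0 (K i).
have p0 : p != 0 by apply/prodf_neq0 => i _; rewrite ffunE.
exists [ffun k => if k == K then p^-1 else 0].
rewrite /form_of (bigD1 K) //= ffunE eqxx mulVf // big1 ?addr0 // => k kK.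
by rewrite ffunE ifN // mul0r.
Qed.

Lemma form_of_eq0 (A : {set 'I_d}) (c : coef_tensor F n A) (j : 'I_d) :
  j \in A -> x j = 0 -> form_of c x = 0.
Proof.
move=> jA xj; rewrite /form_of big1 // => k _.
by rewrite (bigD1 (exist _ j jA)) //= xj mxE mul0r mulr0.
Qed.

End FormOf.

(** * Distribution of the value of the random form at a fixed point *)

Section PointCount.
Variables (F : finFieldType) (d n r : nat) (I : 'I_r -> {set 'I_d}).
Variable x : vpoint F d n.
Local Notation W := (sample F n I).
Local Notation T := (fun w : W => random_form w x).

(** Each [j] lies in [I i] or in its complement, so one factor of every summand vanishes. *)
Lemma random_form_eq0 (w : W) (j : 'I_d) : x j = 0 -> random_form w x = 0.
Proof.
move=> xj; rewrite /random_form big1 // => i _.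
have [jI|jI] := boolP (j \in I i); first by rewrite (form_of_eq0 _ jI) ?mul0r.
by rewrite mulrC (@form_of_eq0 _ _ _ _ _ _ j) ?mul0r // inE.
Qed.

Definition left_values (w : W) : {ffun 'I_r -> F} :=
  [ffun i => form_of (w i).1 x].

Definition shift_left (e : forall i, coef_tensor F n (I i))
    (a : {ffun 'I_r -> F}) (w : W) : W :=
  [ffun i => (tensor_axpy (a i) (e i) (w i).1, (w i).2)].

Definition shift_right (e : forall i, coef_tensor F n (~: I i))
    (a : {ffun 'I_r -> F}) (w : W) : W :=
  [ffun i => ((w i).1, tensor_axpy (a i) (e i) (w i).2)].

Lemma shift_leftE e a w i :
  shift_left e a w i = (tensor_axpy (a i) (e i) (w i).1, (w i).2).
Proof. exact: ffunE. Qed.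

Lemma shift_rightE e a w i :
  shift_right e a w i = ((w i).1, tensor_axpy (a i) (e i) (w i).2).
Proof. exact: ffunE. Qed.

Lemma shift_leftK e a : cancel (shift_left e a) (shift_left e (- a)).
Proof.
move=> w; apply/ffunP => i; rewrite !shift_leftE /= ffunE tensor_axpyK.
by rewrite -surjective_pairing.
Qed.

Lemma shift_rightK e a : cancel (shift_right e a) (shift_right e (- a)).
Proof.
move=> w; apply/ffunP => i; rewrite !shift_rightE /= ffunE tensor_axpyK.
by rewrite -surjective_pairing.
Qed.

Hypothesis x_neq0 : forall j, x j != 0.

(** Shifting each [S_i] by a multiple of a tensor of value 1 at [x] translates [left_values] by any
    prescribed vector, so its [q^r] fibres are equinumerous. *)
Lemma card_left_values0 :
  (#|[pred w : W | left_values w == 0%R]| * #|F| ^ r)%N = #|W|.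
Proof.
have /fin_all_exists [e He] (i : 'I_r) := form_of_eq1 (I i) x_neq0.
have lv a w : left_values (shift_left e a w) = left_values w + a.
  apply/ffunP => i; rewrite [LHS]ffunE shift_leftE /= form_of_axpy He mulr1.
  by rewrite !ffunE.
have fiber c : #|[pred w : W | left_values w == c]| =
               #|[pred w : W | left_values w == 0]|.
  rewrite -(fintype.card_image (can_inj (shift_leftK e (- c)))).
  apply: eq_card => w; apply/fintype.imageP/idP => [[v /[!inE] /eqP vc ->]|].
    by rewrite lv vc subrr.
  rewrite inE => /eqP w0; exists (shift_left e c w).
    by rewrite inE lv w0 add0r.
  by rewrite shift_leftK.
rewrite -[#|W|]sum1_card (partition_big left_values predT) //=.
rewrite (eq_bigr (fun=> #|[pred w : W | left_values w == 0]|)); last first.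
  by move=> c _; rewrite sum1_card -(fiber c).
by rewrite sum_nat_const mulnC card_ffun card_ord.
Qed.

(* When some [S_i(x)] is nonzero, adding to [R_i], for one such [i], a tensor
   of value [t / S_i(x)] translates [T(x)] by [t] without changing the [S_i]. *)
Lemma card_random_form_eq :
  #|[pred w : W | left_values w != 0 & T w == 0]| =
  #|[pred w : W | left_values w != 0 & T w == 1]|.
Proof.
have /fin_all_exists [e He] (i : 'I_r) := form_of_eq1 (~: I i) x_neq0.
(* For [s != 0], a weight vector with [\sum_i a s i * s i = 1], supported on one index where [s] is
   nonzero. *)
pose a (s : {ffun 'I_r -> F}) : {ffun 'I_r -> F} :=
  [ffun i => if [pick j | s j != 0] == Some i then (s i)^-1 else 0].
have sum_a s : s != 0 -> \sum_i a s i * s i = 1.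
  move=> s0; rewrite /a; case: pickP => [j sj|s_0]; last first.
    case/eqP: s0; apply/ffunP => i; rewrite ffunE.
    by apply/eqP; have := s_0 i; case: eqP.
  have aE i : [ffun i => if Some j == Some i then (s i)^-1 else 0] i =
      (if i == j then (s i)^-1 else 0) by rewrite ffunE eq_sym.
  rewrite (bigD1 j) //= aE eqxx mulVf // big1 ?addr0 // => i ij.
  by rewrite aE ifN // mul0r.
pose f (t : F) (w : W) := shift_right e [ffun i => t * a (left_values w) i] w.
have lv t w : left_values (f t w) = left_values w.
  by apply/ffunP => i; rewrite [LHS]ffunE [RHS]ffunE shift_rightE.
(* The shift depends on [w] only through [left_values w], which [f] preserves; hence the opposite
   shift undoes it. *)
have fK t : cancel (f t) (f (- t)).
  move=> w; rewrite {1}/f lv.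
  rewrite -[RHS](shift_rightK e [ffun i => t * a (left_values w) i]).
  by congr shift_right; apply/ffunP => i; rewrite !ffunE mulNr.
have Tf t w : left_values w != 0 -> T (f t w) = T w + t.
  move=> w0; rewrite -[t in RHS]mulr1 -(sum_a _ w0) mulr_sumr.
  rewrite /random_form -big_split /=; apply: eq_bigr => i _.
  by rewrite shift_rightE /= form_of_axpy He !ffunE; ring.
rewrite -(fintype.card_image (can_inj (fK 1))); apply: eq_card => w.
apply/fintype.imageP/idP => [[v /[!inE] /andP [v0 /eqP Tv] ->]|].
  by rewrite lv v0 Tf //= Tv add0r.
rewrite !inE => /andP [w0 /eqP Tw]; exists (f (-1) w).
  by rewrite inE lv w0 Tf //= Tw subrr.
by rewrite -{1}[1]opprK fK.
Qed.

(** Samples with [left_values w != 0] cancel in the difference; the others all give [T w = 0] and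
    make up a fraction [q^-r] of [W]. *)
Lemma card_random_form_gap (R : realFieldType) :
  #|[pred w : W | T w == 0]|%:R - #|[pred w : W | T w == 1]|%:R
  = #|W|%:R * #|F|%:R ^- r :> R.
Proof.
have q0 : (#|F|%:R : R) ^+ r != 0.
  by rewrite expf_neq0 // pnatr_eq0 -lt0n; apply/card_gt0P; exists 0.
have T0 (w : W) : left_values w = 0 -> T w = 0.
  move=> w0; rewrite /random_form big1 // => i _.
  by have /ffunP/(_ i) := w0; rewrite !ffunE => ->; rewrite mul0r.
rewrite -card_left_values0 natrM natrX mulfK //.
have -> : #|[pred w : W | T w == 1]| =
          #|[pred w : W | left_values w != 0 & T w == 1]|.
  apply: eq_card => w; rewrite !inE; apply/esym/andb_idl => /eqP T1.
  by apply/eqP => /T0 /eqP; rewrite T1 oner_eq0.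
rewrite -card_random_form_eq -(cardID [pred w : W | left_values w == 0]).
rewrite natrD -addrA [X in _ + (X - _)](_ : _ =
  #|[pred w : W | left_values w != 0 & T w == 0]|%:R).
  rewrite subrr addr0; congr _%:R; apply: eq_card => w; rewrite !inE.
  by apply: andb_idl => /eqP /T0 ->.
by congr _%:R; apply: eq_card => w; rewrite !inE.
Qed.

End PointCount.

(** * Points with a zero vector among their variables *)

Definition zero_points (F : finFieldType) (d n : nat) : pred (vpoint F d n) :=
  [pred x : vpoint F d n | [exists j, x j == 0]].

Arguments zero_points : clear implicits.

(** Union bound over [j]: replacing the zero vector [x j] by an arbitrary [v] is injective in the
    pair [(x, v)], so [Z j] has density at most [q^-n]. *)
Lemma card_zero_points (F : finFieldType) (d n : nat) :
  (#|zero_points F d n| * #|F| ^ n <= d * #|vpoint F d n|)%N.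
Proof.
pose Z j := [set x : vpoint F d n | x j == 0]%SET.
have HZ j : (#|Z j| * #|F| ^ n <= #|vpoint F d n|)%N.
  have <- : #|[set: 'rV[F]_n]%SET| = (#|F| ^ n)%N.
    by rewrite cardsT card_mx mul1n.
  rewrite -cardsX.
  pose h (p : vpoint F d n * 'rV[F]_n) := set_var p.1 j p.2.
  rewrite -(@card_in_imset _ _ h) ?max_card // => -[x v] [y v'] /=.
  rewrite !inE !andbT /h /= => /eqP xj /eqP yj /ffunP E.
  congr pair; last by have := E j; rewrite !ffunE eqxx.
  apply/ffunP => i; have := E i; rewrite !ffunE.
  by case: eqP => // ->; rewrite xj yj.
have sub : (#|zero_points F d n| <= \sum_j #|Z j|)%N.
  rewrite -(_ : #|(\bigcup_j Z j)%SET| = #|zero_points F d n|).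
    elim/big_rec2: _ => [|j m B _ IH]; first by rewrite cards0.
    by apply: leq_trans (leq_card_setU _ _) _; rewrite leq_add2l.
  apply: eq_card => x; rewrite !inE.
  apply/bigcupP/existsP => [[j _]|[j xj]]; first by rewrite inE; exists j.
  by exists j; rewrite ?inE.
apply: leq_trans (leq_mul sub (leqnn _)) _.
rewrite big_distrl /= -[X in (_ <= X * _)%N]card_ord -sum_nat_const.
exact: leq_sum.
Qed.

(** * Exact expected bias and its asymptotics *)

Lemma expected_biasE (R : realFieldType) (F : finFieldType) (d n r : nat)
    (I : 'I_r -> {set 'I_d}) :
  expected_bias R F n I = #|F|%:R ^- r +
    unif_prob R (zero_points F d n) * (1 - #|F|%:R ^- r).
Proof.
have F0 : (0 < #|F|)%N by apply/card_gt0P; exists 0.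
have W0 : #|sample F n I|%:R != 0 :> R.
  rewrite pnatr_eq0 -lt0n; apply/card_gt0P.
  by exists [ffun i => ([ffun=> 0], [ffun=> 0])].
have V0 : #|vpoint F d n|%:R != 0 :> R.
  by rewrite pnatr_eq0 -lt0n; apply/card_gt0P; exists [ffun=> 0].
(* Double counting of the pairs [(w, x)] at which the form takes the value [a]. *)
have swap a : \sum_(w : sample F n I) #|[pred x | random_form w x == a]|%:R =
    \sum_x #|[pred w : sample F n I | random_form w x == a]|%:R :> R.
  rewrite -!natr_sum; congr _%:R.
  under eq_bigr do rewrite -sum1_card big_mkcond /=.
  rewrite exchange_big /=; apply: eq_bigr => x _.
  by rewrite -sum1_card [RHS]big_mkcond.
rewrite /expected_bias /unif_expect /bias /unif_prob.
under eq_bigr do rewrite -mulrBl.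
rewrite -mulr_suml sumrB !swap -sumrB (bigID (zero_points F d n)) /=.
rewrite (eq_bigr (fun=> #|sample F n I|%:R)); last first.
  move=> x /existsP [j /eqP xj].
  rewrite (eq_card (B := sample F n I)) ?[X in _ - X](_ : _ = 0) ?subr0 //.
    rewrite (eq_card (B := pred0)) ?card0 // => w.
    by rewrite !inE (random_form_eq0 _ xj) eq_sym oner_eq0.
  by move=> w; rewrite !inE (random_form_eq0 _ xj) eqxx.
rewrite [X in _ + X](eq_bigr
    (fun=> #|sample F n I|%:R * #|F|%:R ^- r)); last first.
  move=> x xZ; apply: card_random_form_gap => j.
  by apply: contra xZ => xj; apply/existsP; exists j.
rewrite !sumr_const -[X in _ *+ X + _]/(#|zero_points F d n|).
have /(congr1 (fun m => m%:R : R)) := cardC (zero_points F d n).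
rewrite natrD => VE; rewrite -VE in V0 *.
rewrite -[X in _ + _ *+ X]/(#|[predC zero_points F d n]|).
set A := #|_|; set B := #|_| in V0 *.
by field; rewrite W0 V0 expf_neq0 // pnatr_eq0 -lt0n.
Qed.

Theorem theorem4p4 (R : realType) (F : finFieldType) (d : nat) (eps : R)
    (r : nat -> nat) (I : forall n : nat, 'I_(r n) -> {set 'I_d}) :
  (2 <= d)%N ->
  0 < eps ->
  (forall n : nat, (r n)%:R <= (1 - eps) * n%:R / 2) ->
  (forall (n : nat) (i : 'I_(r n)), nonempty_proper (I n i)) ->
  exists u : nat -> R,
    u n @[n --> \oo] --> (0 : R) /\
    forall n : nat,
      expected_bias R F n (I n) = (1 + u n) * #|F|%:R ^- r n.
Proof.
move=> _ eps0 Hr _.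
have F1 : (1 < #|F|)%N by exact: card_finNzRing_gt1.
have q0 : 0 < (#|F|%:R : R) by rewrite ltr0n ltnW.
(* The relative error obtained by dividing the exact formula by [q^-r]. *)
exists (fun n => unif_prob R (zero_points F d n) * (#|F|%:R ^+ r n - 1)).
split; last first.
  by move=> n; rewrite expected_biasE; field; rewrite expf_neq0 ?lt0r_neq0.
have r2 n : (r n * 2 <= n)%N.
  rewrite -(ler_nat R) natrM -ler_pdivlMr //; apply: le_trans (Hr n) _.
  by rewrite ler_pM2r ?invr_gt0 // ler_piMl // gerBl ltW.
(* The bound [d q^(r-n)] is relaxed to [2d / (n+1)], as [harmonic n] is [1 / (n+1)]. *)
apply: (@squeeze_cvgr _ _ _ _ (fun=> 0) (fun n => (2 * d)%:R * harmonic n)).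
- apply: nearW => n; apply/andP; split.
    by rewrite mulr_ge0 ?divr_ge0 // subr_ge0 exprn_ege1 // ler1n ltnW.
  have V0 : 0 < (#|vpoint F d n|%:R : R).
    by rewrite ltr0n; apply/card_gt0P; exists [ffun=> 0].
  have Hp : unif_prob R (zero_points F d n) <= d%:R / #|F|%:R ^+ n.
    rewrite ler_pdivlMr ?exprn_gt0 // mulrAC ler_pdivrMr //.
    by rewrite -natrX -!natrM ler_nat card_zero_points.
  apply: (@le_trans _ _ (d%:R / #|F|%:R ^+ n * #|F|%:R ^+ r n)).
    apply: ler_pM => //; first by rewrite divr_ge0.
      by rewrite subr_ge0 exprn_ege1 // ler1n ltnW.
    by rewrite gerBl.
  have rn : (r n <= n)%N by apply: leq_trans (r2 n); rewrite leq_pmulr.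
  (* From [m < q^m] with [m = n - r n], and [n <= 2m] because [2 r n <= n]. *)
  have nr : (n.+1 <= 2 * #|F| ^ (n - r n))%N.
    have := ltn_expl (n - r n) F1; have := r2 n; lia.
  rewrite -[X in _ ^+ X](subnK rn) exprD invfM mulrA.
  rewrite mulfVK ?expf_neq0 ?lt0r_neq0 //.
  rewrite /harmonic /= ler_pdivlMr // mulrAC ler_pdivrMr ?exprn_gt0 //.
  by rewrite -natrX -!natrM ler_nat mulnAC [leqLHS]mulnC leq_mul2r nr orbT.
- exact: cvg_cst.
- rewrite -[X in _ --> X](mulr0 (2 * d)%:R).
  by apply: cvgMr; exact: cvg_harmonic.
Qed.
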